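(* Let $G$ be a finite nilpotent group. Suppose that $G=G_1\times G_2\times\cdots\times G_k$, where $G_i$ is the Sylow $p_i$-subgroup of $G$ for $i=1,\dots,k$, and $p_1<p_2<\cdots<p_k$ are the prime divisors of $|G|$. Then $G$ can uniquely be written as the union of three proper subgroups if and only if $p_1=2$ and $G_1$ is generated by exactly two elements.
   Context: A subgroup $H$ of $G$ is proper if $H\neq G$. ''$G$ can uniquely be written as the union of three proper subgroups'' means that there is exactly one (unordered) set $\{H_1,H_2,H_3\}$ of three proper subgroups of $G$ with $G=H_1\cup H_2\cup H_3$. ''$G_1$ is generated by exactly two elements'' means that the minimal number of generators of $G_1$ is two; for a $2$-group $G_1$ this is equivalent to $(G_1:\Phi(G_1))=4$, where $\Phi(G_1)$ is the Frattini subgroup. *)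

(* Defs.v *)
From mathcomp Require Import all_boot all_order all_fingroup all_solvable.

Set Implicit Arguments.
Unset Strict Implicit.
Unset Printing Implicit Defensive.

Local Open Scope group_scope.

(* S is an unordered set {H_1, H_2, H_3}; elements of {group gT} are equal as
   soon as their underlying sets are, so #|S| counts distinct subgroups. *)
Definition is_three_proper_cover (gT : finGroupType) (G : {group gT})
    (S : {set {group gT}}) : Prop :=
  [/\ #|S| = 3,
      forall H : {group gT}, H \in S -> H \proper G &
      \bigcup_(H in S) (H : {set gT}) = G].

Definition uniquely_union_of_three_proper (gT : finGroupType)
    (G : {group gT}) : Prop :=
  exists! S : {set {group gT}}, is_three_proper_cover G S.

(* Main.v *)
Require Import Defs.
From mathcomp Require Import all_boot all_order all_fingroup all_solvable.

Set Implicit Arguments.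
Unset Strict Implicit.
Unset Printing Implicit Defensive.

Local Open Scope group_scope.

(** Three proper subgroups covering G all have index 2, any two distinct
    subgroups of index 2 extend to such a cover, and the third member is then
    determined.  So the cover is unique iff G has exactly three subgroups of
    index 2, i.e. iff their intersection D has index 4 in G.  If G is nilpotent
    with Sylow 2-subgroup P, a subgroup of index 2 contains every element of odd
    order and meets P in P or in a maximal subgroup, so D = 'Phi(P) 'O_2^'(G) and
    #|G : D| = #|P : 'Phi(P)|, which is 2 ^ 'm(P) by Burnside's basis theorem. *)

(** * Subgroups of index 2 *)

Section Index2.

Variable gT : finGroupType.
Implicit Types (G H K L M N P A : {group gT}) (S : {set {group gT}}).

(** If [h] outside [H] lies in [K] and [k] outside [K] lies in [H], then [h * k] lies in neither. *)
Lemma proper_setU_avoid G H K :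
  H \proper G -> K \proper G -> exists2 y, y \in G & (y \notin H) && (y \notin K).
Proof.
case/properP=> _ [h Gh H'h] /properP[_ [k Gk K'k]].
have [Kh | K'h] := boolP (h \in K); last by exists h; rewrite ?H'h.
have [Hk | H'k] := boolP (k \in H); last by exists k; rewrite ?H'k.
by exists (h * k); [rewrite groupM | rewrite groupMr // groupMl // H'h].
Qed.

(** For [x] outside [H], the product condition makes right translation by [x] send [G :\: H] into
    [H], so [H] and [H :* x^-1] cover [G]. This is the form of index 2 that a cover yields
    directly. *)
Lemma index2P G H : H \subset G ->
  #|G : H| = 2 <->
  H \proper G /\ {in G & G, forall x y, x \notin H -> y \notin H -> x * y \in H}.
Proof.
move=> sHG; split=> [iH | [/properP[_ [x Gx H'x]] HM]].
  split; first by rewrite properE sHG -indexg_gt1 iH.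
  move=> x y Gx Gy H'x H'y.
  have: x \in G :\: H by rewrite inE H'x.
  have: y^-1 \in G :\: H by rewrite inE !groupV H'y.
  by move/(rcoset_index2 sHG iH)=> <-; rewrite mem_rcoset invgK.
apply/eqP; rewrite eqn_leq indexg_gt1 andbC.
have -> /= : ~~ (G \subset H) by apply/subsetPn; exists x.
rewrite -(leq_pmul2l (cardG_gt0 H)) Lagrange // muln2 -addnn.
rewrite -{2}(card_rcoset H x^-1) (leq_trans _ (leq_card_setU _ _)) //.
apply/subset_leq_card/subsetP=> y Gy; rewrite inE mem_rcoset invgK.
by have [//| H'y] := boolP (y \in H); rewrite HM.
Qed.

(** Boolean equality is the group law of order 2, so membership acts as the character of [G] with
    kernel [H]. *)
Lemma mem_index2M G H : H \subset G -> #|G : H| = 2 ->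
  {in G & G, forall x y, (x * y \in H) = ((x \in H) == (y \in H))}.
Proof.
move=> sHG /(index2P sHG)[_ HM] x y Gx Gy.
have [Hx | H'x] := boolP (x \in H); first by rewrite groupMl.
have [Hy | H'y] := boolP (y \in H); first by rewrite groupMr // (negPf H'x).
by rewrite HM.
Qed.

Lemma index2_setI G H A : H \subset G -> #|G : H| = 2 ->
  A \subset G -> ~~ (A \subset H) -> #|A : A :&: H| = 2.
Proof.
move=> sHG /(index2P sHG)[_ HM] sAG nsAH.
apply/(index2P (subsetIl A H)); split=> [|x y Ax Ay].
  by rewrite properE subsetIl subsetI subxx.
rewrite !inE Ax Ay groupM //=; apply: HM; exact: (subsetP sAG).
Qed.

Lemma index2_neq G H K : H \subset G -> K \subset G ->
  #|G : H| = 2 -> #|G : K| = 2 -> H != K -> ~~ (H \subset K).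
Proof.
move=> sHG sKG iH iK; apply: contra => sHK.
have: #|K : H| == 1%N.
  by rewrite -(eqn_pmul2l (indexg_gt0 G K)) Lagrange_index // iH iK.
by rewrite indexg_eq1 -val_eqE eqEsubset sHK.
Qed.

Lemma index_setI_index2 G H K : H \subset G -> K \subset G ->
  #|G : H| = 2 -> #|G : K| = 2 -> H != K -> #|G : H :&: K| = 4.
Proof.
move=> sHG sKG iH iK neHK; rewrite -(Lagrange_index sHG (subsetIl H K)) iH.
by rewrite (index2_setI sKG) // (index2_neq sHG sKG).
Qed.

(** * Covers by three proper subgroups *)

(** Some [w] of [G] avoids [H] and [K], so it lies in [L]; for [x] in [H :&: K] the same holds of
    [x * w], hence [x] is in [L]. *)
Lemma proper_cover_setIS G H K L : H \proper G -> K \proper G ->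
  {in G, forall x, [|| x \in H, x \in K | x \in L]} -> H :&: K \subset L.
Proof.
move=> prH prK cov; apply/subsetP=> x /setIP[Hx Kx].
have [w Gw /andP[H'w K'w]] := proper_setU_avoid prH prK.
have:= cov w Gw; rewrite (negPf H'w) (negPf K'w) /= => Lw.
have:= cov (x * w) (groupM (subsetP (proper_sub prH) x Hx) Gw).
by rewrite (groupMl w Hx) (groupMl w Kx) (negPf H'w) (negPf K'w) (groupMr x Lw).
Qed.

Lemma three_proper_coverD1 G S H : is_three_proper_cover G S -> H \in S ->
  exists K L, [/\ S = [set H; K; L], K \proper G, L \proper G &
    {in G, forall x, [|| x \in H, x \in K | x \in L]}].
Proof.
case=> cardS prS covS SH.
have /cards2P[K [L [_ defKL]]]: #|S :\ H| == 2.
  by move: (cardsD1 H S); rewrite SH cardS add1n => -[<-].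
have defS: S = [set H; K; L] by rewrite -(setD1K SH) defKL setUA.
exists K, L; split=> //; try by apply: prS; rewrite defS !inE eqxx ?orbT.
move=> x; rewrite -covS => /bigcupP[M]; rewrite defS !inE -orbA.
by case/or3P=> /eqP-> ->; rewrite ?orbT.
Qed.

(** Outside [H] every element of [G] lies in exactly one of [K] and [L], since [K :&: L] is
    contained in [H]. A product of one of each kind avoids both [K] and [L], so it falls in [H]. *)
Lemma three_proper_cover_index2 G S H :
  is_three_proper_cover G S -> H \in S -> #|G : H| = 2.
Proof.
move=> covS SH; have prH: H \proper G by case: covS => _ /(_ H SH).
have [K [L [_ prK prL cov]]] := three_proper_coverD1 covS SH.
apply/(index2P (proper_sub prH)); split=> // x y Gx Gy H'x H'y.
have KLH z: z \in K -> z \in L -> z \in H.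
  move=> Kz Lz; have: z \in K :&: L by rewrite inE Kz.
  by apply/subsetP/(proper_cover_setIS prK prL) => t /cov; rewrite orbC orbA.
have diff u v: u \in G -> v \in G -> u \notin H -> v \notin H -> u \in K -> v \in L ->
    u * v \in H.
  move=> Gu Gv H'u H'v Ku Lv; have:= cov _ (groupM Gu Gv).
  rewrite (groupMl v Ku) (groupMr u Lv).
  have [Kv|_] := boolP (v \in K); first by rewrite (KLH v) in H'v.
  by have [Lu|_] := boolP (u \in L); rewrite ?orbF // (KLH u) in H'u *.
have inKL u: u \in G -> u \notin H -> (u \in K) || (u \in L).
  by move=> Gu /negPf H'u; have:= cov u Gu; rewrite H'u.
have diffV u v: u \in G -> v \in G -> u \notin H -> v \notin H -> u \in L -> v \in K ->
    u * v \in H.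
  by move=> Gu Gv H'u H'v Lu Kv; rewrite -groupV invMg diff ?groupV.
have [w Gw /andP[H'w K'w]] := proper_setU_avoid prH prK.
have [v Gv /andP[H'v L'v]] := proper_setU_avoid prH prL.
have Lw: w \in L by have:= inKL w Gw H'w; rewrite (negPf K'w).
have Kv: v \in K by have:= inKL v Gv H'v; rewrite (negPf L'v) orbF.
case/orP: (inKL x Gx H'x) => [Kx | Lx]; case/orP: (inKL y Gy H'y) => [Ky | Ly].
(* Both factors lie in [K]: inserting [w * w^-1] with [w] in [L] gives two mixed products. *)
- rewrite -[x](mulgK w) -mulgA; apply: groupM; first exact: diff.
  by apply: diffV; rewrite ?groupV.
- exact: diff.
- exact: diffV.
- rewrite -[x](mulgK v) -mulgA; apply: groupM; first exact: diffV.
  by apply: diff; rewrite ?groupV.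
Qed.

Lemma index2_cover G H K : H \subset G -> K \subset G ->
  #|G : H| = 2 -> #|G : K| = 2 -> H != K ->
  exists2 S, is_three_proper_cover G S & (H \in S) && (K \in S).
Proof.
move=> sHG sKG iH iK neHK.
(* The kernel of the product of the characters with kernels [H] and [K]; it takes in everything
   outside both. *)
pose Lset := [set x in G | (x \in H) == (x \in K)].
have gL: group_set Lset.
  apply/group_setP; split=> [|x y]; rewrite !inE ?group1 //.
  case/andP=> Gx /eqP HKx /andP[Gy /eqP HKy]; rewrite groupM //=.
  by rewrite (mem_index2M sHG) ?(mem_index2M sKG) ?HKx ?HKy.
pose L := Group gL.
have /subsetPn[x Hx K'x] := index2_neq sHG sKG iH iK neHK.
have /subsetPn[y Ky H'y]: ~~ (K \subset H).
  by apply: (@index2_neq G); rewrite // eq_sym.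
have L'x: x \notin L by rewrite !inE Hx (negPf K'x) andbF.
have L'y: y \notin L by rewrite !inE Ky (negPf H'y) andbF.
have neHL: H != L by apply: contraNneq L'x => <-.
have neKL: K != L by apply: contraNneq L'y => <-.
have [Gx Gy] := (subsetP sHG x Hx, subsetP sKG y Ky).
exists [set H; K; L]; last by rewrite !inE !eqxx orbT.
split=> [|M|].
- by rewrite setUC cardsU1 cards2 !inE neHK negb_or ![L == _]eq_sym neHL neKL.
- rewrite !inE -orbA => /or3P[]/eqP->; apply/properP; split=> //.
  + by exists y.
  + by exists x.
  + by apply/subsetP=> z; rewrite inE => /andP[].
  + by exists x.
apply/setP=> z; apply/bigcupP/idP=> [[M] | Gz].
  rewrite !inE -orbA => /or3P[]/eqP->; [exact: (subsetP sHG)| exact: (subsetP sKG) |].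
  by rewrite inE => /andP[].
have [Hz | H'z] := boolP (z \in H); first by exists H; rewrite // !inE eqxx.
have [Kz | K'z] := boolP (z \in K); first by exists K; rewrite // !inE eqxx orbT.
by exists L; rewrite !inE ?eqxx ?orbT // Gz (negPf H'z) (negPf K'z).
Qed.

(** * The intersection of the subgroups of index 2 *)

(** The factor [G] matters when there is no subgroup of index 2: the empty intersection is all of
    [gT]. *)
Definition index2_core G : {set gT} :=
  G :&: \bigcap_(M : {group gT} | (M \subset G) && (#|G : M| == 2)) M.

Canonical index2_core_group G := [group of index2_core G].

Lemma index2_coreP G x :
  reflect (x \in G /\ forall M, M \subset G -> #|G : M| = 2 -> x \in M)
          (x \in index2_core G).
Proof.
rewrite inE; apply: (iffP andP) => -[Gx Mx]; split=> //.
  by move=> M sMG iM; apply: (bigcapP Mx); rewrite sMG iM.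
by apply/bigcapP=> M /andP[sMG /eqP]; apply: Mx.
Qed.

Lemma index2_core_sub G : index2_core G \subset G.
Proof. exact: subsetIl. Qed.

Lemma index2_coreS G M :
  M \subset G -> #|G : M| = 2 -> index2_core G \subset M.
Proof. by move=> sMG iM; apply/subsetP=> x /index2_coreP[_]; apply. Qed.

Lemma unique_three_proper_coverE G :
  uniquely_union_of_three_proper G <-> #|G : index2_core G| = 4.
Proof.
split=> [[S [covS uniqS]] | iD].
  (* A member [H] of [S] other than [M] extends with [M] to a cover, which is [S] by uniqueness. *)
  have inS M: M \subset G -> #|G : M| = 2 -> M \in S.
    move=> sMG iM; have [cardS prS _] := covS.
    have /subsetPn[H SH neHM]: ~~ (S \subset [set M]).
      by apply: contraTN isT => /subset_leq_card; rewrite cardS cards1.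
    have neHM' : H != M by rewrite inE in neHM.
    have iH := three_proper_cover_index2 covS SH.
    have [T covT /andP[_ TM]] :=
      index2_cover (proper_sub (prS H SH)) sMG iH iM neHM'.
    by rewrite (uniqS T covT).
  have [H SH]: exists H, H \in S by apply/set0Pn; rewrite -card_gt0; case: covS => ->.
  have [K [L [defS prK prL cov]]] := three_proper_coverD1 covS SH.
  have [cardS prS _] := covS.
  have sSG M : M \in S -> M \subset G by move/prS/proper_sub.
  have [SK SL]: K \in S /\ L \in S by rewrite defS !inE !eqxx !orbT.
  have iS M : M \in S -> #|G : M| = 2 by apply: three_proper_cover_index2 covS.
  have neHK: H != K.
    by apply/eqP=> eqHK; move: cardS; rewrite defS eqHK setUid cards2; case: eqP.
  have -> : index2_core G = H :&: K; last by rewrite index_setI_index2 ?sSG ?iS.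
  apply/eqP; rewrite eqEsubset subsetI !index2_coreS ?sSG ?iS //=.
  apply/subsetP=> x /setIP[Hx Kx]; apply/index2_coreP.
  have Gx: x \in G by apply: subsetP (sSG H SH) x Hx.
  split=> // M sMG /(inS M sMG); rewrite defS !inE -orbA.
  case/or3P=> /eqP-> //.
  by apply: (subsetP (proper_cover_setIS (prS H SH) prK cov)); rewrite inE Hx.
have sepD x: x \in G -> x \notin index2_core G ->
    exists M : {group gT}, [/\ M \subset G, #|G : M| = 2 & x \notin M].
  move=> Gx; rewrite inE Gx /= => D'x; have: [exists M : {group gT},
      [&& M \subset G, #|G : M| == 2 & x \notin M]].
    apply: contraR D'x => /existsPn D'x; apply/bigcapP=> M /andP[sMG iM].
    by have:= D'x M; rewrite sMG iM negbK.
  by case/existsP=> M /and3P[sMG /eqP iM M'x]; exists M.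
have sDG := index2_core_sub G.
have /subsetPn[x Gx D'x]: ~~ (G \subset index2_core G).
  by rewrite -indexg_gt1 iD.
have [H [sHG iH H'x]] := sepD x Gx D'x.
have [sDH prH] := (index2_coreS sHG iH, proj1 (proj1 (index2P sHG) iH)).
have /subsetPn[y Hy D'y]: ~~ (H \subset index2_core G).
  apply/negP=> sHD; move: iD.
  have <- : H :=: index2_core G by apply/eqP; rewrite eqEsubset sHD.
  by rewrite iH.
have [K [sKG iK K'y]] := sepD y (subsetP sHG y Hy) D'y.
have neHK: H != K by apply: contraNneq K'y => <-.
(* The intersection contains the core, and both have index 4. *)
have tiI (A B : {group gT}) : A \subset G -> B \subset G ->
    #|G : A| = 2 -> #|G : B| = 2 -> A != B -> A :&: B = index2_core G.
  move=> sAG sBG iA iB neAB; apply/esym/eqP.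
  rewrite eqEcard subsetI !index2_coreS //=.
  rewrite -(leq_pmul2r (isT : 0 < 4)) -{1}(index_setI_index2 sAG sBG iA iB neAB) -iD.
  by rewrite !Lagrange ?index2_core_sub // subIset ?sAG.
have [S covS /andP[SH _]] := index2_cover sHG sKG iH iK neHK.
exists S; split=> // T covT; have [[cardS prS bigS] [cardT prT _]] := (covS, covT).
apply/esym/eqP; rewrite eqEcard cardS cardT leqnn andbT; apply/subsetP=> M TM.
have [sMG iM] := (proper_sub (prT M TM), three_proper_cover_index2 covT TM).
(* Were [M] outside [S], it would be the union of its intersections with the members of [S], each
   equal to the core; but [M] has index 2. *)
apply: contraT => S'M; have sMD: M \subset index2_core G.
  apply/subsetP=> z Mz; have: z \in G by apply: subsetP Mz.
  rewrite -bigS => /bigcupP[A SA Az].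
  have neAM: A != M by apply: contraNneq S'M => <-.
  have [sAG iA] := (proper_sub (prS A SA), three_proper_cover_index2 covS SA).
  by rewrite -(tiI A M) // inE Az.
have: #|G : M| = #|G : index2_core G|.
  by congr #|G : _|; apply/eqP; rewrite eqEsubset sMD index2_coreS.
by rewrite iM iD.
Qed.

Lemma index_dprodr P N G A :
  P \x N = G -> A \subset P -> #|G : A * N| = #|P : A|.
Proof.
move=> defG sAP; have [_ defPN cPN tiPN] := dprodP defG.
have tiAN: A :&: N = 1 by apply/trivgP; rewrite -tiPN setSI.
have cAN : N \subset 'C(A) by rewrite (subset_trans cPN) ?centS.
have sANG : A <*> N \subset G.
  by rewrite join_subG -defPN (subset_trans sAP) ?mulG_subl ?mulG_subr.
have defAN := cent_joinEr cAN; rewrite -defAN -!divgS //= -(dprod_card defG).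
by rewrite defAN TI_cardMg // divnMr.
Qed.

End Index2.

(** * Burnside's basis theorem *)

(** Lifts of a smallest generating set of the quotient generate [G] together with ['Phi(G)], whose
    elements are non-generators. *)
Lemma grank_quotient_Phi (gT : finGroupType) (G : {group gT}) :
  'm(G / 'Phi(G)) = 'm(G).
Proof.
have nPhiG := normal_norm (Phi_normal G).
apply/eqP; rewrite eqn_leq quotient_grank //=.
have [B defB <-] := grank_witness (G / 'Phi(G)).
have lift : forall xb, xb \in B -> exists2 x, x \in G & coset 'Phi(G) x = xb.
  move=> xb Bxb; have: xb \in G / 'Phi(G) by rewrite -defB mem_gen.
  by case/morphimP=> x _ Gx ->; exists x.
(* A choice of lifts; the default [1] is never reached on [B]. *)
pose f (xb : coset_of 'Phi(G)) := odflt 1 [pick x in G | coset 'Phi(G) x == xb].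
have fP xb : xb \in B -> f xb \in G /\ coset 'Phi(G) (f xb) = xb.
  rewrite /f => /lift[x Gx dx]; case: pickP => [y /andP[Gy /eqP]|/(_ x)] //.
  by rewrite Gx dx eqxx.
have sfG : f @: B \subset G by apply/subsetP=> _ /imsetP[xb /fP[Gx _] ->].
apply: leq_trans (leq_imset_card f (mem B)); apply: leq_trans (grank_min (f @: B)).
suff -> : <<f @: B>> = G by [].
apply: Phi_nongen; apply/eqP; rewrite eqEsubset join_subG Phi_sub sfG /=.
have sHG: <<f @: B>> \subset G by rewrite gen_subG.
rewrite -joing_idr norm_joinEr ?(subset_trans sHG) // -quotientSK //.
rewrite -defB gen_subG; apply/subsetP=> xb Bxb; have [Gx <-] := fP xb Bxb.
by rewrite mem_quotient // mem_gen ?imset_f.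
Qed.

(** The Frattini quotient is elementary abelian, so its order is [p] to its rank, which is its
    number of generators. *)
Lemma pgroup_index_Phi (gT : finGroupType) (p : nat) (P : {group gT}) :
  p.-group P -> #|P : 'Phi(P)| = (p ^ 'm(P))%N.
Proof.
move=> pP; have abP := Phi_quotient_abelem pP.
rewrite -card_quotient ?normal_norm ?Phi_normal //.
rewrite (card_pgroup (abelem_pgroup abP)) -rank_abelem //.
rewrite -grank_abelian ?grank_quotient_Phi //.
exact: abelem_abelian abP.
Qed.

(** * Reduction to the Sylow 2-subgroup *)

Section Nilpotent.

Variables (gT : finGroupType) (G : {group gT}).
Hypothesis nilG : nilpotent G.

Lemma index2_core_nilpotent : index2_core G = 'Phi('O_2(G)) * 'O_2^'(G).
Proof.
have defG := nilpotent_pcoreC 2 nilG; have [_ defPN cPN tiPN] := dprodP defG.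
set P := 'O_2(G) in defG defPN cPN tiPN *.
set N := 'O_2^'(G) in defG defPN cPN tiPN *.
have pP: 2.-group P := pcore_pgroup 2 G.
have sPG: P \subset G := pcore_sub 2 G.
have sNG: N \subset G := pcore_sub _ G.
have sND: N \subset index2_core G.
  apply/subsetP=> x Nx; have Gx := subsetP sNG x Nx; apply/index2_coreP.
  split=> // M sMG iM; have oddx: odd #[x].
    by have:= mem_p_elt (pcore_pgroup 2^' G) Nx; rewrite /p_elt p'natE // dvdn2 negbK.
  (* As [#[x]] is odd, [x] times a power of [x ^+ 2] is [1], so [x] is in [M] too. *)
  have Mx2: x ^+ 2 \in M by rewrite (mem_index2M sMG) ?eqxx.
  have:= expg_order x; rewrite -[#[x]]odd_double_half oddx -mul2n expgD expgM => x1.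
  by rewrite -(groupMr x (groupX #[x]./2 Mx2)) -[x in x * _]expg1 x1 group1.
apply/eqP; rewrite eqEsubset mulG_subG sND andbT; apply/andP; split.
  apply/subsetP=> x Dx; have Gx := subsetP (index2_core_sub G) x Dx.
  move: Gx; rewrite -defPN => /mulsgP[y n Py Nn dx]; rewrite dx mem_mulg //.
  have Dy: y \in index2_core G by rewrite -(groupMr y (subsetP sND n Nn)) -dx.
  apply/bigcapP=> M /predU1P[-> // | maxM]; have sMP := proper_sub (maxgroupp maxM).
  (* A maximal subgroup [M] of [P] gives [M * N] of index 2 in [G], so [y] lies in it; the modular
     law then cuts [M * N :&: P] down to [M]. *)
  have [cMN iM]: N \subset 'C(M) /\ #|G : M * N| = 2.
    by rewrite (subset_trans cPN) ?centS // (index_dprodr defG) ?(p_maximal_index pP).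
  have: y \in M <*> N.
    have [_] := (index2_coreP _ _ Dy); apply; last by rewrite /= cent_joinEr.
    by rewrite join_subG (subset_trans sMP).
  rewrite cent_joinEr // => My; have: y \in M * N :&: P by rewrite inE My.
  by rewrite -group_modl // setIC tiPN mulg1.
apply/subsetP=> x Phix; have Px := subsetP (Phi_sub P) x Phix.
apply/index2_coreP; split=> [|M sMG iM]; first exact: (subsetP sPG).
have [sPM | nsPM] := boolP (P \subset M); first exact: (subsetP sPM).
(* Index 2 in [P] makes the trace of [M] maximal, so it contains ['Phi(P)]. *)
have maxM: maximal (P :&: M) P.
  by rewrite (p_index_maximal (subsetIl _ _)) // (index2_setI sMG).
by have /setIP[] := subsetP (Phi_sub_max maxM) x Phix.
Qed.

Lemma index_index2_core_nilpotent : #|G : index2_core G| = (2 ^ 'm('O_2(G)))%N.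
Proof.
rewrite index2_core_nilpotent (index_dprodr (nilpotent_pcoreC 2 nilG)) ?Phi_sub //.
exact/pgroup_index_Phi/pcore_pgroup.
Qed.

Lemma unique_three_proper_cover_nilpotent :
  uniquely_union_of_three_proper G <-> 'm('O_2(G)) = 2.
Proof.
apply: iff_trans (unique_three_proper_coverE G) _.
rewrite index_index2_core_nilpotent; split=> [/eqP | -> //].
by rewrite (@eqn_exp2l 2 _ 2) // => /eqP.
Qed.

End Nilpotent.

Theorem corollaryE (gT : finGroupType) (G : {group gT}) (nilG : nilpotent G)
    (k : nat) (p : 'I_k -> nat) (Gi : 'I_k -> {group gT})
    (p_incr : forall i j : 'I_k, (i < j)%N -> (p i < p j)%N)
    (p_primes : forall q : nat,
        (prime q /\ (q %| #|G|)%N) <-> exists i : 'I_k, p i = q)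
    (sylGi : forall i : 'I_k, (p i).-Sylow(G) (Gi i))
    (defG : \big[dprod/1]_(i < k) (Gi i : {set gT}) = G) :
  uniquely_union_of_three_proper G <->
  exists k_gt0 : (0 < k)%N,
    p (Ordinal k_gt0) = 2 /\ 'm(Gi (Ordinal k_gt0)) = 2.
Proof.
have GiE i : p i = 2 -> Gi i :=: 'O_2(G).
  by move=> pi2; apply: nilpotent_Hall_pcore; rewrite // -pi2.
apply: iff_trans (unique_three_proper_cover_nilpotent nilG) _.
split=> [mP | [k_gt0 [p0 mGi]]]; last by rewrite -(GiE _ p0).
have [i pi2]: exists i, p i = 2.
  (* The trivial group has generator rank 0, so here 2 divides the order of [G]. *)
  have ntP: 'O_2(G) != 1.
    by apply/eqP=> P1; move: mP; rewrite P1 grank_abelian ?abelian1 ?rank1.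
  have [_ d2P _] := pgroup_pdiv (pcore_pgroup 2 G) ntP.
  by apply/p_primes; split; rewrite ?(dvdn_trans d2P) ?cardSg ?pcore_sub.
have k_gt0 := leq_ltn_trans (leq0n i) (ltn_ord i).
exists k_gt0; have [i0 | i_gt0] := posnP i.
  have -> : Ordinal k_gt0 = i by apply: val_inj.
  by rewrite GiE.
(* Otherwise the first prime would be smaller than 2. *)
have [/prime_gt1 p0_gt1 _] : prime (p (Ordinal k_gt0)) /\ p (Ordinal k_gt0) %| #|G|.
  by apply/p_primes; exists (Ordinal k_gt0).
by have:= p_incr (Ordinal k_gt0) i i_gt0; rewrite pi2 ltnNge p0_gt1.
Qed.
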